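(* Let $\mathcal{M}$ be any model of $\mathbf{ZF}+\neg\mathbf{IQDI}$. Then it holds in $\mathcal{M}$ that there exists an infinite Hausdorff space $\mathbf{X}$ such that the Boolean algebra $RO(\mathbf{X})$ has a tower but some infinite Boolean subalgebra of $RO(\mathbf{X})$ does not have a tower.
   Context: No form of the axiom of choice is assumed. A set is infinite if it is not equipotent with any $n\in\omega$, and denumerable if it is equipotent with $\omega$. $\mathbf{IQDI}$: for every infinite set $X$, the set $[X]^{<\omega}$ of all finite subsets of $X$ has a denumerable subset. $RO(\mathbf{X})$ is the Boolean algebra of all regular open sets of $\mathbf{X}$, i.e. sets $U$ with $U=int(\overline{U})$ (meet $U\cap V$, join $int(\overline{U\cup V})$, complement $X\setminus\overline{U}$). A tower of a Boolean algebra is a strictly decreasing sequence $(t_n)_{n\in\omega}$ of its elements. *)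

(* Defs.v *)
Set Implicit Arguments.
Unset Strict Implicit.

(** Structures for the first-order language of set theory, equality being
    interpreted as actual equality. *)

Record structure : Type := Structure {
  univ :> Type;
  mem : univ -> univ -> Prop
}.

Notation "x ∈ y" := (mem x y) (at level 70, no associativity).

(** First-order formulas with de Bruijn indices; the free variables that are
    not otherwise used play the role of parameters in the axiom schemes. *)

Inductive formula : Type :=
| fMem (i j : nat)
| fEq  (i j : nat)
| fNot (p : formula)
| fAnd (p q : formula)
| fOr  (p q : formula)
| fImp (p q : formula)
| fAll (p : formula)
| fEx  (p : formula).

Definition scons (T : Type) (x : T) (rho : nat -> T) (n : nat) : T :=
  match n with O => x | S k => rho k end.

Fixpoint sat (M : structure) (rho : nat -> M) (p : formula) : Prop :=
  match p with
  | fMem i j => rho i ∈ rho j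
  | fEq i j  => rho i = rho j
  | fNot p   => ~ sat rho p
  | fAnd p q => sat rho p /\ sat rho q
  | fOr p q  => sat rho p \/ sat rho q
  | fImp p q => sat rho p -> sat rho q
  | fAll p   => forall x : M, sat (scons x rho) p
  | fEx p    => exists x : M, sat (scons x rho) p
  end.

(** The notions below are all evaluated inside a structure [M]: a "set" is an
    element of [M] and every quantifier ranges over elements of [M].
    Set-theoretic operations are given by their graphs. *)

Definition subset (M : structure) (x y : M) : Prop :=
  forall z : M, z ∈ x -> z ∈ y.

Definition is_empty (M : structure) (x : M) : Prop :=
  forall z : M, ~ z ∈ x.

Definition is_upair (M : structure) (x y p : M) : Prop :=
  forall z : M, z ∈ p <-> z = x \/ z = y.

Definition is_opair (M : structure) (x y p : M) : Prop :=
  exists s t : M, is_upair x x s /\ is_upair x y t /\ is_upair s t p.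

Definition is_bigunion (M : structure) (x u : M) : Prop :=
  forall z : M, z ∈ u <-> exists y : M, y ∈ x /\ z ∈ y.

Definition is_powerset (M : structure) (x p : M) : Prop :=
  forall z : M, z ∈ p <-> subset z x.

Definition is_inter (M : structure) (x y u : M) : Prop :=
  forall z : M, z ∈ u <-> z ∈ x /\ z ∈ y.

Definition is_union (M : structure) (x y u : M) : Prop :=
  forall z : M, z ∈ u <-> z ∈ x \/ z ∈ y.

Definition is_diff (M : structure) (x y u : M) : Prop :=
  forall z : M, z ∈ u <-> z ∈ x /\ ~ z ∈ y.

Definition is_succ (M : structure) (x s : M) : Prop :=
  forall z : M, z ∈ s <-> z ∈ x \/ z = x.

Definition inductive (M : structure) (w : M) : Prop :=
  (exists e : M, is_empty e /\ e ∈ w) /\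
  (forall x : M, x ∈ w -> exists s : M, is_succ x s /\ s ∈ w).

Record ZF_model (M : structure) : Prop := {
  ZF_extensionality :
    forall x y : M, (forall z : M, z ∈ x <-> z ∈ y) -> x = y;
  ZF_foundation :
    forall x : M, (exists y : M, y ∈ x) ->
      exists y : M, y ∈ x /\ ~ (exists z : M, z ∈ x /\ z ∈ y);
  ZF_pairing :
    forall x y : M, exists p : M, is_upair x y p;
  ZF_union :
    forall x : M, exists u : M, is_bigunion x u;
  ZF_powerset :
    forall x : M, exists p : M, is_powerset x p;
  ZF_infinity :
    exists w : M, inductive w;
  ZF_separation :
    forall (phi : formula) (rho : nat -> M) (a : M),
      exists b : M, forall x : M,
        x ∈ b <-> x ∈ a /\ sat (scons x rho) phi;
  ZF_replacement :
    forall (phi : formula) (rho : nat -> M) (a : M),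
      (forall x y y' : M, x ∈ a ->
         sat (scons x (scons y rho)) phi ->
         sat (scons x (scons y' rho)) phi -> y = y') ->
      exists b : M, forall y : M,
        y ∈ b <-> exists x : M, x ∈ a /\ sat (scons x (scons y rho)) phi
}.

Definition is_omega (M : structure) (w : M) : Prop :=
  inductive w /\ forall v : M, inductive v -> subset w v.

Definition app (M : structure) (f x y : M) : Prop :=
  exists p : M, is_opair x y p /\ p ∈ f.

Definition is_function (M : structure) (f A B : M) : Prop :=
  (forall p : M, p ∈ f ->
     exists a b : M, a ∈ A /\ b ∈ B /\ is_opair a b p) /\
  (forall a : M, a ∈ A -> exists b : M, app f a b) /\
  (forall a b b' : M, app f a b -> app f a b' -> b = b').

Definition is_bijection (M : structure) (f A B : M) : Prop :=
  is_function f A B /\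
  (forall a a' b : M, app f a b -> app f a' b -> a = a') /\
  (forall b : M, b ∈ B -> exists a : M, app f a b).

Definition equipotent (M : structure) (A B : M) : Prop :=
  exists f : M, is_bijection f A B.

Definition finite (M : structure) (A : M) : Prop :=
  exists w n : M, is_omega w /\ n ∈ w /\ equipotent A n.

Definition infinite (M : structure) (A : M) : Prop := ~ finite A.

Definition denumerable (M : structure) (A : M) : Prop :=
  exists w : M, is_omega w /\ equipotent A w.

Definition is_finite_powerset (M : structure) (X F : M) : Prop :=
  forall A : M, A ∈ F <-> subset A X /\ finite A.

Definition IQDI (M : structure) : Prop :=
  forall X F : M, infinite X -> is_finite_powerset X F ->
    exists D : M, subset D F /\ denumerable D.

Definition topology (M : structure) (X T : M) : Prop :=
  (forall U : M, U ∈ T -> subset U X) /\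
  (forall e : M, is_empty e -> e ∈ T) /\
  X ∈ T /\
  (forall U V W : M, U ∈ T -> V ∈ T -> is_inter U V W -> W ∈ T) /\
  (forall S W : M, subset S T -> is_bigunion S W -> W ∈ T).

Definition hausdorff (M : structure) (X T : M) : Prop :=
  forall x y : M, x ∈ X -> y ∈ X -> x <> y ->
    exists U V : M, U ∈ T /\ V ∈ T /\ x ∈ U /\ y ∈ V /\
      ~ (exists z : M, z ∈ U /\ z ∈ V).

Definition is_interior (M : structure) (X T A I : M) : Prop :=
  forall z : M, z ∈ I <-> exists U : M, U ∈ T /\ subset U A /\ z ∈ U.

Definition is_closure (M : structure) (X T A C : M) : Prop :=
  forall z : M, z ∈ C <->
    z ∈ X /\ forall U : M, U ∈ T -> z ∈ U -> exists y : M, y ∈ U /\ y ∈ A.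

Definition regular_open (M : structure) (X T U : M) : Prop :=
  subset U X /\
  exists C : M, is_closure X T U C /\ is_interior X T C U.

(** A Boolean algebra of [M] is presented by its underlying set together with
    the graphs of its operations. *)

Record algebra (M : structure) : Type := Algebra {
  alg_set   : M;
  alg_bot   : M -> Prop;
  alg_top   : M -> Prop;
  alg_meet  : M -> M -> M -> Prop;
  alg_join  : M -> M -> M -> Prop;
  alg_compl : M -> M -> Prop
}.

Definition alg_lt (M : structure) (A : algebra M) (a b : M) : Prop :=
  alg_meet A a b a /\ a <> b.

(** The order of omega is membership. *)
Definition is_tower (M : structure) (A : algebra M) (t : M) : Prop :=
  exists w : M, is_omega w /\ is_function t w (alg_set A) /\
    forall m n a b : M, m ∈ w -> n ∈ w -> m ∈ n ->
      app t m a -> app t n b -> alg_lt A b a.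

Definition has_tower (M : structure) (A : algebra M) : Prop :=
  exists t : M, is_tower A t.

Definition is_subalgebra (M : structure) (A : algebra M) (S : M) : Prop :=
  subset S (alg_set A) /\
  (exists o : M, alg_bot A o /\ o ∈ S) /\
  (exists i : M, alg_top A i /\ i ∈ S) /\
  (forall a b c : M, a ∈ S -> b ∈ S -> alg_meet A a b c -> c ∈ S) /\
  (forall a b c : M, a ∈ S -> b ∈ S -> alg_join A a b c -> c ∈ S) /\
  (forall a c : M, a ∈ S -> alg_compl A a c -> c ∈ S).

Definition subalgebra (M : structure) (A : algebra M) (S : M) : algebra M :=
  {| alg_set := S;
     alg_bot := alg_bot A;
     alg_top := alg_top A;
     alg_meet := alg_meet A;
     alg_join := alg_join A;
     alg_compl := alg_compl A |}.

Definition is_RO_set (M : structure) (X T R : M) : Prop :=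
  forall U : M, U ∈ R <-> regular_open X T U.

(** [R] is meant to be the set of regular open sets, i.e. [is_RO_set X T R]. *)
Definition RO (M : structure) (X T R : M) : algebra M :=
  {| alg_set := R;
     alg_bot := fun U => is_empty U;
     alg_top := fun U => U = X;
     alg_meet := fun U V W => is_inter U V W;
     alg_join := fun U V W =>
       exists P C : M, is_union U V P /\ is_closure X T P C /\
         is_interior X T C W;
     alg_compl := fun U W =>
       exists C : M, is_closure X T U C /\ is_diff X C W |}.

(* Main.v *)
(** Let [X] be an infinite set such that [[X]^{<ω}] has no denumerable subset,
    put [Y = X ∪ ω] and give [Y] the discrete topology, so that [RO(Y)] is the
    power set of [Y] and [n ↦ Y \ n] is a tower.  The finite subsets of [X]
    and their complements in [Y] form an infinite subalgebra [S].  If [t] were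
    a tower of [S], let [d_n] be whichever of [t_n], [Y \ t_n] is a finite
    subset of [X] (preferring [t_n]).  No [t_n] is empty, hence [n ↦ d_n] is
    injective: [d_m = d_n] with [m < n] leaves only [t_n = Y \ t_m], which
    together with [t_n ⊆ t_m] makes [t_n] empty.  So [[X]^{<ω}] would have a
    denumerable subset. *)

Require Import Defs.
From Stdlib Require Import Classical.

Set Implicit Arguments.
Unset Strict Implicit.

Section Model.

Context (M : structure) (hZF : ZF_model M).

(** * Definable predicates on environments *)

(** The axiom schemes range over syntactic formulas. Describing formulas by the predicates they
    induce on environments lets properties be written as Rocq propositions, with parameters read off
    the environment. *)
Definition definable (P : (nat -> M) -> Prop) : Prop :=
  exists phi : formula, forall rho, sat rho phi <-> P rho.

Lemma definable_mem i j : definable (fun e => e i ∈ e j).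
Proof. exists (fMem i j); reflexivity. Qed.

Lemma definable_eq i j : definable (fun e => e i = e j).
Proof. exists (fEq i j); reflexivity. Qed.

Lemma definable_not P : definable P -> definable (fun e => ~ P e).
Proof. intros [p Hp]; exists (fNot p); intros rho; simpl; now rewrite Hp. Qed.

Lemma definable_and P Q :
  definable P -> definable Q -> definable (fun e => P e /\ Q e).
Proof.
intros [p Hp] [q Hq]; exists (fAnd p q); intros rho; simpl.
now rewrite Hp, Hq.
Qed.

Lemma definable_or P Q :
  definable P -> definable Q -> definable (fun e => P e \/ Q e).
Proof.
intros [p Hp] [q Hq]; exists (fOr p q); intros rho; simpl.
now rewrite Hp, Hq.
Qed.

Lemma definable_imp P Q :
  definable P -> definable Q -> definable (fun e => P e -> Q e).
Proof.
intros [p Hp] [q Hq]; exists (fImp p q); intros rho; simpl.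
now rewrite Hp, Hq.
Qed.

(** The bound variable takes index 0 and all others shift by one; evaluating the premise at
    [scons x rho] then gives back [P x rho] by conversion. *)
Lemma definable_all (P : M -> (nat -> M) -> Prop) :
  definable (fun e => P (e 0) (fun n => e (S n))) ->
  definable (fun e => forall x, P x e).
Proof.
intros [p Hp]; exists (fAll p); intros rho; simpl.
split; intros H x; apply (Hp (scons x rho)), H.
Qed.

Lemma definable_ex (P : M -> (nat -> M) -> Prop) :
  definable (fun e => P (e 0) (fun n => e (S n))) ->
  definable (fun e => exists x, P x e).
Proof.
intros [p Hp]; exists (fEx p); intros rho; simpl.
split; intros [x H]; exists x; apply (Hp (scons x rho)), H.
Qed.

(** Reduces set-theoretic notions to membership and equality, then follows the connectives; [iff] is
    unfolded because formulas have no biconditional. *)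
Ltac definable :=
  unfold finite, equipotent, is_bijection, is_function, app, is_opair,
    is_upair, is_omega, inductive, is_succ, is_empty, is_diff, is_union,
    is_inter, subset, iff;
  repeat (cbv beta;
    first [ apply definable_mem | apply definable_eq | apply definable_not
          | apply definable_and | apply definable_or | apply definable_imp
          | apply definable_all | apply definable_ex ]).

Lemma separation P rho (a : M) : definable P ->
  exists b : M, forall x : M, x ∈ b <-> x ∈ a /\ P (scons x rho).
Proof.
intros [p Hp]; destruct (ZF_separation hZF p rho a) as [b Hb].
exists b; intros x; rewrite Hb, Hp; reflexivity.
Qed.

(** * Elementary constructions *)

Definition ext := ZF_extensionality hZF.

(** Foundation applied to [{x}]: its only element [x] must be disjoint from [{x}]. *)
Lemma not_mem_self (x : M) : ~ x ∈ x.
Proof.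
intros Hx; destruct (ZF_pairing hZF x x) as [p Hp].
destruct (ZF_foundation hZF (x := p)) as [y [Hy Hn]].
- exists x; apply Hp; now left.
- apply Hn; exists x; assert (y = x) by (apply Hp in Hy; tauto); subst y.
  auto.
Qed.

Lemma singleton_exists (x : M) : exists s : M, forall z : M, z ∈ s <-> z = x.
Proof.
destruct (ZF_pairing hZF x x) as [p Hp]; exists p.
intros z; rewrite (Hp z); tauto.
Qed.

Lemma union_exists (a b : M) : exists u : M, is_union a b u.
Proof.
destruct (ZF_pairing hZF a b) as [p Hp], (ZF_union hZF p) as [u Hu].
exists u; intros z; rewrite (Hu z); split.
- intros [y [Hy Hz]]; apply Hp in Hy; destruct Hy; subst y; auto.
- intros [Hz|Hz]; [exists a | exists b]; split; auto; apply Hp; auto.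
Qed.

Lemma adjoin_exists (a x : M) :
  exists s : M, forall z : M, z ∈ s <-> z ∈ a \/ z = x.
Proof.
destruct (singleton_exists x) as [p Hp], (union_exists a p) as [u Hu].
exists u; intros z; rewrite (Hu z), Hp; reflexivity.
Qed.

Lemma diff_exists (a b : M) : exists d : M, is_diff a b d.
Proof.
(* Index 0 is the candidate element that [separation] puts in front, index 1 the parameter [b]; the
   constant tail merely completes the environment. *)
destruct (@separation (fun e => ~ e 0 ∈ e 1) (scons b (fun _ => b)) a)
  as [d Hd]; [definable | exists d; exact Hd].
Qed.

Lemma inter_exists (a b : M) : exists d : M, is_inter a b d.
Proof.
destruct (@separation (fun e => e 0 ∈ e 1) (scons b (fun _ => b)) a)
  as [d Hd]; [definable | exists d; exact Hd].
Qed.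

(** * Ordered pairs and functions given by definable relations *)

Lemma opair_exists (x y : M) : exists p : M, is_opair x y p.
Proof.
destruct (ZF_pairing hZF x x) as [s Hs], (ZF_pairing hZF x y) as [t Ht].
destruct (ZF_pairing hZF s t) as [p Hp]; exists p, s, t; auto.
Qed.

Lemma upair_inj (x y x' y' p : M) : is_upair x y p -> is_upair x' y' p ->
  x = x' /\ y = y' \/ x = y' /\ y = x'.
Proof.
intros H H'.
assert (Hx : x = x' \/ x = y') by (apply H', H; auto).
assert (Hy : y = x' \/ y = y') by (apply H', H; auto).
assert (Hx' : x' = x \/ x' = y) by (apply H, H'; auto).
assert (Hy' : y' = x \/ y' = y) by (apply H, H'; auto).
intuition congruence.
Qed.

Lemma opair_inj (x y x' y' p : M) : is_opair x y p -> is_opair x' y' p ->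
  x = x' /\ y = y'.
Proof.
intros [s [t [Hs [Ht Hp]]]] [s' [t' [Hs' [Ht' Hp']]]].
destruct (upair_inj Hp Hp') as [[-> ->]|[-> ->]].
- destruct (upair_inj Hs Hs') as [[-> _]|[-> _]];
  destruct (upair_inj Ht Ht') as [[? ?]|[? ?]]; intuition congruence.
- destruct (upair_inj Hs Ht') as [[? ?]|[? ?]];
  destruct (upair_inj Ht Hs') as [[? ?]|[? ?]]; intuition congruence.
Qed.

(** Kuratowski pairs lie in the double power set of [A ∪ B]. An upper bound is enough, since graphs
    are then cut out by separation. *)
Lemma product_bound (A B : M) : exists C : M, forall x y p : M,
  x ∈ A -> y ∈ B -> is_opair x y p -> p ∈ C.
Proof.
destruct (union_exists A B) as [U HU], (ZF_powerset hZF U) as [P HP].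
destruct (ZF_powerset hZF P) as [C HC]; exists C.
intros x y p Hx Hy [s [t [Hs [Ht Hp]]]]; apply HC; intros z Hz.
apply HP; intros v Hv; apply HU; apply Hp in Hz; destruct Hz; subst z.
- apply Hs in Hv; destruct Hv; subst; auto.
- apply Ht in Hv; destruct Hv; subst; auto.
Qed.

(* The environment of [Q] lists the value, the argument and a dummy (the
   ordered pair itself) before the parameters. *)
Lemma graph_exists Q rho (A B : M) (R : M -> M -> Prop) : definable Q ->
  (forall x y p : M, Q (scons y (scons x (scons p rho))) <-> R x y) ->
  (forall x y : M, R x y -> x ∈ A /\ y ∈ B) ->
  exists f : M,
    (forall p : M, p ∈ f -> exists x y : M, x ∈ A /\ y ∈ B /\ is_opair x y p) /\
    (forall x y : M, app f x y <-> R x y).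
Proof.
intros [q Hq] HQ HR.
assert (D : definable (fun e => is_opair (e 1) (e 0) (e 2))) by definable.
destruct D as [o Ho], (product_bound A B) as [C HC].
destruct (ZF_separation hZF (fEx (fEx (fAnd o q))) rho C) as [f Hf].
assert (Hf' : forall p : M,
  p ∈ f <-> p ∈ C /\ exists x y : M, is_opair x y p /\ R x y).
{ intros p; rewrite Hf; simpl.
  split; intros [Hp [x [y H]]]; split; auto; exists x, y;
    rewrite Ho, Hq, HQ in *; exact H. }
exists f; split.
- intros p Hp; apply Hf' in Hp; destruct Hp as [_ [x [y [Hp HRxy]]]].
  destruct (HR _ _ HRxy); exists x, y; auto.
- intros x y; split.
  + intros [p [Hp Hpf]]; apply Hf' in Hpf.
    destruct Hpf as [_ [x' [y' [Hp' HRxy]]]].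
    now destruct (opair_inj Hp Hp') as [-> ->].
  + intros H; destruct (opair_exists x y) as [p Hp], (HR _ _ H).
    exists p; split; auto; apply Hf'; split; [eapply HC; eauto | eauto].
Qed.

Lemma function_exists Q rho (A B : M) (R : M -> M -> Prop) : definable Q ->
  (forall x y p : M, Q (scons y (scons x (scons p rho))) <-> R x y) ->
  (forall x y : M, R x y -> x ∈ A /\ y ∈ B) ->
  (forall x : M, x ∈ A -> exists y : M, R x y) ->
  (forall x y y' : M, R x y -> R x y' -> y = y') ->
  exists f : M, is_function f A B /\ forall x y : M, app f x y <-> R x y.
Proof.
intros HQ HQR HR Htot Hfun.
destruct (graph_exists HQ HQR HR) as [f [Hf HfR]].
exists f; split; auto; split; [exact Hf | split].
- intros a Ha; destruct (Htot a Ha) as [b Hb]; exists b; now apply HfR.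
- intros a b b'; rewrite !HfR; apply Hfun.
Qed.

Lemma equipotent_of_relation Q rho (A B : M) (R : M -> M -> Prop) :
  definable Q ->
  (forall x y p : M, Q (scons y (scons x (scons p rho))) <-> R x y) ->
  (forall x y : M, R x y -> x ∈ A /\ y ∈ B) ->
  (forall x : M, x ∈ A -> exists y : M, R x y) ->
  (forall x y y' : M, R x y -> R x y' -> y = y') ->
  (forall x x' y : M, R x y -> R x' y -> x = x') ->
  (forall y : M, y ∈ B -> exists x : M, R x y) ->
  equipotent A B.
Proof.
intros HQ HQR HR Htot Hfun Hinj Hsurj.
destruct (function_exists HQ HQR HR Htot Hfun) as [f [Hf HfR]].
exists f; split; [exact Hf | split].
- intros a a' b; rewrite !HfR; apply Hinj.
- intros b Hb; destruct (Hsurj b Hb) as [a Ha]; exists a; now apply HfR.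
Qed.

Lemma app_in (f A B x y : M) :
  is_function f A B -> app f x y -> x ∈ A /\ y ∈ B.
Proof.
intros [Hf _] [p [Hp Hpf]]; destruct (Hf _ Hpf) as [a [b [Ha [Hb Hab]]]].
now destruct (opair_inj Hp Hab) as [-> ->].
Qed.

(** * Natural numbers *)

(** The intersection of all inductive sets, separated from the one that infinity provides. *)
Lemma omega_exists : exists w : M, is_omega w.
Proof.
destruct (ZF_infinity hZF) as [v Hv].
destruct (@separation (fun e => forall u, inductive u -> e 0 ∈ u)
  (fun _ => v) v) as [w Hw]; [definable | cbn in Hw].
exists w; split; [split |].
- destruct Hv as [[o [Ho Hov]] _]; exists o; split; auto.
  apply Hw; split; auto; intros u [[o' [Ho' Hu]] _].
  replace o with o'; auto; apply ext; intros z.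
  split; intros Hz; [destruct (Ho' z Hz) | destruct (Ho z Hz)].
- intros x Hx; apply Hw in Hx; destruct Hx as [Hx Hxu].
  destruct (adjoin_exists x x) as [s Hs].
  assert (Hall : forall u, inductive u -> s ∈ u).
  { intros u Hu; destruct (proj2 Hu x (Hxu u Hu)) as [s' [Hs' Hsu]].
    replace s with s'; auto; apply ext; intros z; rewrite (Hs z), (Hs' z).
    reflexivity. }
  exists s; split; auto; apply Hw; auto.
- intros u Hu x Hx; apply Hw in Hx; now apply Hx.
Qed.

Context (w : M) (Hw : is_omega w).

Lemma omega_unique (v : M) : is_omega v -> v = w.
Proof.
destruct Hw as [Hw1 Hw2]; intros [Hv1 Hv2]; apply ext; intros z.
split; [apply Hv2 | apply Hw2]; auto.
Qed.

Lemma empty_exists : exists o : M, is_empty o /\ o ∈ w.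
Proof. apply Hw. Qed.

Lemma empty_unique (o o' : M) : is_empty o -> is_empty o' -> o = o'.
Proof.
intros H H'; apply ext; intros z.
split; intros Hz; [destruct (H z Hz) | destruct (H' z Hz)].
Qed.

Lemma omega_succ (n s : M) : n ∈ w -> is_succ n s -> s ∈ w.
Proof.
intros Hn Hs; destruct Hw as [[_ H] _], (H n Hn) as [s' [Hs' H']].
replace s with s'; auto; apply ext; intros z; rewrite (Hs z), (Hs' z).
reflexivity.
Qed.

(** By separation the elements of [w] satisfying [P] form a set; it is inductive, so it contains [w]
    by minimality. *)
Lemma omega_ind P rho : definable P ->
  (forall o : M, is_empty o -> P (scons o rho)) ->
  (forall n s : M, n ∈ w -> is_succ n s -> P (scons n rho) ->
     P (scons s rho)) ->
  forall n : M, n ∈ w -> P (scons n rho).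
Proof.
intros HP H0 HS; destruct (separation rho w HP) as [u Hu].
assert (Hi : inductive u).
{ split.
  - destruct empty_exists as [o [Ho How]]; exists o; split; auto.
    apply Hu; auto.
  - intros x Hx; apply Hu in Hx; destruct Hx as [Hx HPx].
    destruct (adjoin_exists x x) as [s Hs]; exists s; split; auto.
    apply Hu; split; [eapply omega_succ | eapply HS]; eauto. }
intros n Hn; apply Hu; now apply (proj2 Hw).
Qed.

Lemma omega_elt_trans (n m k : M) : n ∈ w -> m ∈ n -> k ∈ m -> k ∈ n.
Proof.
intros Hn; revert m k.
apply (@omega_ind (fun e => forall m k, m ∈ e 0 -> k ∈ m -> k ∈ e 0)
  (fun _ => w)); auto; clear n Hn; cbn; [definable | |].
- intros o Ho m k Hm; destruct (Ho m Hm).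
- intros n s Hn Hs IH m k Hm Hk; apply Hs; left.
  apply Hs in Hm; destruct Hm; [eauto | subst; auto].
Qed.

Lemma omega_succ_le (n m s : M) : m ∈ w -> n ∈ m -> is_succ n s ->
  s ∈ m \/ s = m.
Proof.
intros Hm; revert n s.
apply (@omega_ind (fun e => forall n s, n ∈ e 0 -> is_succ n s ->
  s ∈ e 0 \/ s = e 0) (fun _ => w)); auto; clear m Hm; cbn; [definable | |].
- intros o Ho n s Hn; destruct (Ho n Hn).
- intros m s Hm Hs IH n s' Hn Hs'; apply Hs in Hn; destruct Hn as [Hn|Hn].
  + left; apply Hs; eauto.
  + subst n; right; apply ext; intros z; rewrite (Hs z), (Hs' z); reflexivity.
Qed.

Lemma omega_zero_le (o n : M) : is_empty o -> n ∈ w -> o = n \/ o ∈ n.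
Proof.
intros Ho; apply (@omega_ind (fun e => e 1 = e 0 \/ e 1 ∈ e 0)
  (scons o (fun _ => w))); cbn; [definable | |].
- intros o' Ho'; left; now apply empty_unique.
- intros m s _ Hs [H|H]; right; apply Hs; auto.
Qed.

(** Induction on [n], with [m] quantified inside the predicate; when [n ∈ m], [omega_succ_le]
    compares the successor of [n] with [m]. *)
Lemma omega_total (n m : M) : n ∈ w -> m ∈ w -> m ∈ n \/ m = n \/ n ∈ m.
Proof.
intros Hn; revert m.
apply (@omega_ind (fun e => forall m, m ∈ e 1 ->
  m ∈ e 0 \/ m = e 0 \/ e 0 ∈ m) (scons w (fun _ => w)));
  auto; clear n Hn; cbn; [definable | |].
- intros o Ho m Hm; destruct (omega_zero_le Ho Hm); auto.
- intros n s Hn Hs IH m Hm; destruct (IH m Hm) as [H|[H|H]].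
  + left; apply Hs; auto.
  + left; apply Hs; auto.
  + destruct (omega_succ_le Hm H Hs); auto.
Qed.

(** * Finite sets *)

Lemma finite_equipotent (A : M) :
  finite A <-> exists n : M, n ∈ w /\ equipotent A n.
Proof.
split.
- intros [v [n [Hv [Hn H]]]]; apply omega_unique in Hv; subst v; eauto.
- intros [n [Hn H]]; exists w, n; auto.
Qed.

Lemma finite_empty (o : M) : is_empty o -> finite o.
Proof.
intros Ho; destruct empty_exists as [o' [Ho' Hw']].
apply finite_equipotent; exists o'; split; auto.
rewrite (empty_unique Ho Ho').
(* Since [o'] has no elements this relation never holds: it is the empty bijection. *)
apply (@equipotent_of_relation (fun e => e 0 ∈ e 3 /\ e 0 = e 1)
  (scons o' (fun _ => w)) _ _ (fun x y => y ∈ o' /\ y = x));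
  [definable | reflexivity | ..].
all: try (intros x y [H _]; destruct (Ho' _ H)).
all: try (intros x y z [H _]; destruct (Ho' _ H)).
all: intros x H; destruct (Ho' _ H).
Qed.

(** A bijection from [A] to [n] extends by [x ↦ n] to one onto the successor of [n], unless [x] is
    already in [A]. A clash of values would give [n ∈ n]. *)
Lemma finite_adjoin (A x B : M) : finite A ->
  (forall z : M, z ∈ B <-> z ∈ A \/ z = x) -> finite B.
Proof.
intros HA HB; destruct (classic (x ∈ A)) as [Hx|Hx].
{ replace B with A; auto; apply ext; intros z; rewrite HB.
  split; auto; now intros [H| ->]. }
apply finite_equipotent in HA; destruct HA as [n [Hn [f [Hf [Hinj Hsurj]]]]].
destruct (adjoin_exists n n) as [s Hs].
apply finite_equipotent; exists s; split; [eapply omega_succ; eauto |].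
assert (Hin := fun a b => @app_in f A n a b Hf).
apply (@equipotent_of_relation
  (fun e => app (e 3) (e 1) (e 0) \/ e 1 = e 4 /\ e 0 = e 5)
  (scons f (scons x (scons n (fun _ => w)))) _ _
  (fun a b => app f a b \/ a = x /\ b = n)); [definable | reflexivity | ..].
- intros a b [H|[-> ->]].
  + destruct (Hin _ _ H); split; [apply HB | apply Hs]; auto.
  + split; [apply HB | apply Hs]; auto.
- intros a Ha; apply HB in Ha; destruct Ha as [Ha| ->].
  + destruct (proj1 (proj2 Hf) a Ha) as [b Hb]; eauto.
  + eauto.
- intros a b b' [H|[Ha ->]] [H'|[Ha' ->]]; auto.
  + eapply Hf; eauto.
  + subst a; apply Hin in H; tauto.
  + subst a; apply Hin in H'; tauto.
- intros a a' b [H|[-> Hb]] [H'|[-> Hb']]; auto.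
  + eapply Hinj; eauto.
  + subst b; apply Hin in H; destruct (not_mem_self (proj2 H)).
  + subst b; apply Hin in H'; destruct (not_mem_self (proj2 H')).
- intros b Hb; apply Hs in Hb; destruct Hb as [Hb| ->].
  + destruct (Hsurj b Hb) as [a Ha]; eauto.
  + eauto.
Qed.

(* Quantifying over the set [G] rather than over a formula keeps the statement
   first-order, so that it can itself be proved by [omega_ind]. *)
Lemma finite_in_closed (A G : M) : finite A ->
  (forall o : M, is_empty o -> o ∈ G) ->
  (forall C x C' : M, C ∈ G -> x ∈ A -> subset C A ->
     (forall z : M, z ∈ C' <-> z ∈ C \/ z = x) -> C' ∈ G) ->
  A ∈ G.
Proof.
intros HA; apply finite_equipotent in HA; destruct HA as [n [Hn HA]].
revert A G HA.
apply (@omega_ind (fun e => forall A G, equipotent A (e 0) ->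
  (forall o : M, is_empty o -> o ∈ G) ->
  (forall C x C' : M, C ∈ G -> x ∈ A -> subset C A ->
     (forall z : M, z ∈ C' <-> z ∈ C \/ z = x) -> C' ∈ G) ->
  A ∈ G) (fun _ => w)); auto; clear n Hn; cbn; [definable | |].
- intros o Ho A G [f [Hf _]] H0 _; apply H0; intros a Ha.
  destruct (proj1 (proj2 Hf) a Ha) as [b Hb].
  apply (app_in Hf) in Hb; apply (Ho b); tauto.
- intros n s Hn Hs IH A G [f [Hf [Hinj Hsurj]]] H0 HG.
  (* Removing the preimage [x] of [n] leaves a set [C] that [f] maps bijectively onto [n], so the
     induction hypothesis applies to [C]. *)
  destruct (Hsurj n) as [x Hx]; [apply Hs; auto |].
  destruct (singleton_exists x) as [p Hp], (diff_exists A p) as [C HC].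
  assert (HC' : forall z, z ∈ C <-> z ∈ A /\ z <> x).
  { intros z; rewrite (HC z), Hp; reflexivity. }
  assert (HxA : x ∈ A) by (apply (app_in Hf) in Hx; tauto).
  assert (HCA : subset C A) by (intros z Hz; apply HC' in Hz; tauto).
  apply (HG C x A); auto.
  + apply IH; auto.
    * apply (@equipotent_of_relation
        (fun e => app (e 3) (e 1) (e 0) /\ e 1 ∈ e 4)
        (scons f (scons C (fun _ => w))) _ _
        (fun a b => app f a b /\ a ∈ C)); [definable | reflexivity | ..].
      -- intros a b [H Ha]; split; auto.
         destruct (app_in Hf H) as [_ Hb]; apply Hs in Hb.
         destruct Hb as [Hb| ->]; auto.
         (* The value [n] is excluded: injectivity would force [a = x], but [x] was removed. *)
         apply HC' in Ha; destruct (proj2 Ha); eauto.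
      -- intros a Ha; destruct (proj1 (proj2 Hf) a (HCA a Ha)) as [b Hb].
         eauto.
      -- intros a b b' [H _] [H' _]; eapply Hf; eauto.
      -- intros a a' b [H _] [H' _]; eauto.
      -- intros b Hb; destruct (Hsurj b) as [a Ha]; [apply Hs; auto |].
         exists a; split; auto; apply HC'; split.
         ++ apply (app_in Hf) in Ha; tauto.
         (* If the preimage of [b ∈ n] were [x], then [b = n]. *)
         ++ intros ->; apply (@not_mem_self n).
            now rewrite (proj2 (proj2 Hf) _ _ _ Hx Ha) at 1.
    * intros D y D' HD Hy HDC HD'; apply (HG D y D'); auto.
      intros z Hz; auto.
  + intros z; rewrite HC'; split; [| now intros [H| ->]].
    intros Hz; destruct (classic (z = x)); auto.
Qed.

(** Take for [G] in [finite_in_closed] the set of subsets of [A] satisfying [P]; adjoining elements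
    of [A] only keeps everything inside the power set of [A]. *)
Lemma finite_ind P rho (A : M) : definable P -> finite A ->
  (forall o : M, is_empty o -> P (scons o rho)) ->
  (forall C x C' : M, P (scons C rho) -> x ∈ A -> subset C A ->
     (forall z : M, z ∈ C' <-> z ∈ C \/ z = x) -> P (scons C' rho)) ->
  P (scons A rho).
Proof.
intros HP HA H0 HS.
destruct (ZF_powerset hZF A) as [PA HPA], (separation rho PA HP) as [G HG].
apply HG, finite_in_closed; auto.
- intros o Ho; apply HG; split; auto; apply HPA; intros z Hz.
  destruct (Ho z Hz).
- intros C x C' HC Hx HCA HC'; apply HG in HC; destruct HC as [_ HC].
  apply HG; split; [| eapply HS; eauto].
  apply HPA; intros z Hz; apply HC' in Hz; destruct Hz as [Hz| ->]; auto.
Qed.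

(** Induction on [A]: a subset of [C ∪ {x}] is its intersection with [C], together with at most the
    point [x]. *)
Lemma finite_subset (A B : M) : finite A -> subset B A -> finite B.
Proof.
intros HA; revert B.
apply (@finite_ind (fun e => forall B, subset B (e 0) -> finite B)
  (fun _ => w) A); cbn; [definable | auto | |].
- intros o Ho B HB; apply finite_empty; intros z Hz; apply (Ho z); auto.
- intros C x C' IH _ _ HC' B HB.
  destruct (inter_exists B C) as [D HD].
  assert (HDfin : finite D) by (apply IH; intros z Hz; apply HD in Hz; tauto).
  destruct (classic (x ∈ B)) as [Hx|Hx].
  + apply (finite_adjoin (x := x) HDfin); intros z; rewrite (HD z).
    split; [| now intros [[H _]| ->]].
    intros Hz; destruct (proj1 (HC' z) (HB z Hz)); auto.
  + replace B with D; auto; apply ext; intros z; rewrite (HD z).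
    split; [tauto |]; intros Hz.
    destruct (proj1 (HC' z) (HB z Hz)) as [H| ->]; tauto.
Qed.

Lemma finite_union (A B C : M) : finite A -> finite B -> is_union A B C ->
  finite C.
Proof.
intros HA HB; revert C.
apply (@finite_ind (fun e => forall C, is_union (e 0) (e 1) C -> finite C)
  (scons B (fun _ => w)) A); cbn; [definable | auto | |].
- intros o Ho C HC; apply (finite_subset HB); intros z Hz.
  apply HC in Hz; destruct Hz as [Hz|Hz]; auto; destruct (Ho z Hz).
- intros A0 x A1 IH _ _ HA1 C HC.
  destruct (union_exists A0 B) as [D HD].
  apply (finite_adjoin (x := x) (IH D HD)); intros z.
  rewrite (HC z), (HD z), HA1; tauto.
Qed.

(** This replaces counting along the injection [x ↦ {x}], and is what makes the finite-cofinite
    algebra infinite. *)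
Lemma finite_of_singletons (X E : M) : finite E ->
  (forall x s : M, x ∈ X -> is_upair x x s -> s ∈ E) -> finite X.
Proof.
intros HE HX.
(* For the induction on [E], all of [X] is replaced by the set of those [x ∈ X] whose singleton lies
   in [E]. *)
assert (H : forall C : M,
  (forall x : M, x ∈ C <->
     x ∈ X /\ forall s : M, is_upair x x s -> s ∈ E) -> finite C).
{ apply (@finite_ind (fun e => forall C : M, (forall x : M, x ∈ C <->
     x ∈ e 1 /\ forall s : M, is_upair x x s -> s ∈ e 0) -> finite C)
    (scons X (fun _ => w)) E); cbn; [definable | auto | |].
  - intros o Ho C HC; apply finite_empty; intros x Hx; apply HC in Hx.
    destruct (ZF_pairing hZF x x) as [s Hs], (Ho s); now apply Hx.
  - intros D y D' IH _ _ HD' C HC.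
    destruct (@separation (fun e => forall s : M, is_upair (e 0) (e 0) s ->
      s ∈ e 1) (scons D (fun _ => w)) X) as [B HB]; [definable | cbn in HB].
    assert (HBfin := IH B HB).
    assert (HBC : forall z, z ∈ C -> z ∈ B \/ is_upair z z y).
    { intros z Hz; apply HC in Hz; destruct Hz as [Hz Hs].
      destruct (classic (is_upair z z y)) as [|Hy]; auto; left.
      apply HB; split; auto; intros s Hsz.
      destruct (proj1 (HD' s) (Hs s Hsz)) as [|Hsy]; auto; subst; tauto. }
    (* The new element [y] is the singleton of at most one [x], so at most one point is gained. *)
    destruct (classic (exists x, is_upair x x y)) as [[x Hx]|Hx].
    + destruct (adjoin_exists B x) as [B' HB'].
      apply (@finite_subset B'); [eapply finite_adjoin; eauto |].
      intros z Hz; apply HB'; destruct (HBC z Hz) as [|Hzy]; auto; right.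
      destruct (upair_inj Hx Hzy); intuition congruence.
    + apply (finite_subset HBfin); intros z Hz.
      destruct (HBC z Hz); auto; destruct Hx; eauto. }
apply H; intros x; split; [| tauto]; intros Hx; split; eauto.
Qed.

(** * Discrete spaces *)

Context (Y T : M) (HT : is_powerset Y T).

Lemma discrete_topology : topology Y T.
Proof.
repeat split.
- intros U HU; now apply HT.
- intros e He; apply HT; intros z Hz; destruct (He z Hz).
- apply HT; intros z; auto.
- intros U V W HU _ HW; apply HT in HU; apply HT; intros z Hz.
  apply HU; apply HW in Hz; tauto.
- intros E W HE HW; apply HT; intros z Hz; apply HW in Hz.
  destruct Hz as [y [Hy Hz]]; apply HE in Hy; apply HT in Hy; auto.
Qed.

Lemma singleton_open (x : M) : x ∈ Y ->
  exists s : M, s ∈ T /\ forall z : M, z ∈ s <-> z = x.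
Proof.
intros Hx; destruct (singleton_exists x) as [s Hs]; exists s; split; auto.
apply HT; intros z Hz; apply Hs in Hz; now subst.
Qed.

Lemma discrete_hausdorff : hausdorff Y T.
Proof.
intros x y Hx Hy Hxy.
destruct (singleton_open Hx) as [s [HsT Hs]].
destruct (singleton_open Hy) as [t [HtT Ht]].
exists s, t; rewrite Hs, Ht; repeat split; auto.
intros [z [Hz Hz']]; rewrite Hs in Hz; rewrite Ht in Hz'; congruence.
Qed.

Lemma discrete_closure (A : M) : subset A Y -> is_closure Y T A A.
Proof.
intros HA z; split.
- intros Hz; split; auto; intros U _ HU; eauto.
- intros [Hz H]; destruct (singleton_open Hz) as [s [HsT Hs]].
  destruct (H s HsT) as [y [Hy HyA]]; [now apply Hs |].
  apply Hs in Hy; now subst.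
Qed.

Lemma discrete_interior (A : M) : subset A Y -> is_interior Y T A A.
Proof.
intros HA z; split.
- intros Hz; exists A; repeat split; auto; [now apply HT | intros v; auto].
- intros [U [_ [HU Hz]]]; auto.
Qed.

Lemma closure_unique (A C C' : M) :
  is_closure Y T A C -> is_closure Y T A C' -> C = C'.
Proof.
intros H H'; apply ext; intros z; rewrite (H z), (H' z); reflexivity.
Qed.

Lemma interior_unique (A I I' : M) :
  is_interior Y T A I -> is_interior Y T A I' -> I = I'.
Proof.
intros H H'; apply ext; intros z; rewrite (H z), (H' z); reflexivity.
Qed.

(** Every subset of a discrete space is its own closure and its own interior, so [T] serves both as
    the topology and as the carrier of the algebra. *)
Lemma discrete_RO_set : is_RO_set Y T T.
Proof.
intros U; rewrite (HT U); split.
- intros HU; split; auto; exists U.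
  split; [now apply discrete_closure | now apply discrete_interior].
- now intros [H _].
Qed.

Lemma discrete_join (U V W : M) : subset U Y -> subset V Y ->
  alg_join (RO Y T T) U V W -> is_union U V W.
Proof.
intros HU HV [P [C [HP [HC HW]]]].
assert (HPY : subset P Y).
{ intros z Hz; apply HP in Hz; destruct Hz; auto. }
rewrite (closure_unique HC (discrete_closure HPY)) in HW.
now rewrite (interior_unique HW (discrete_interior HPY)).
Qed.

Lemma discrete_compl (U W : M) : subset U Y ->
  alg_compl (RO Y T T) U W -> is_diff Y U W.
Proof.
intros HU [C [HC HW]].
now rewrite (closure_unique HC (discrete_closure HU)) in HW.
Qed.

Lemma powerset_has_tower : subset w Y -> has_tower (RO Y T T).
Proof.
intros HwY.
destruct (@function_exists (fun e => e 1 ∈ e 3 /\ is_diff (e 4) (e 1) (e 0))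
  (scons w (scons Y (fun _ => w))) w T
  (fun n b => n ∈ w /\ is_diff Y n b)) as [t [Ht HtR]];
  [definable | reflexivity | ..].
- intros n b [Hn Hb]; split; auto; apply HT; intros z Hz; apply Hb in Hz.
  tauto.
- intros n Hn; destruct (diff_exists Y n) as [b Hb]; eauto.
- intros n b b' [_ H] [_ H']; apply ext; intros z.
  rewrite (H z), (H' z); reflexivity.
- exists t, w; split; [exact Hw | split; [exact Ht |]].
  intros m n a b Hm Hn Hmn Ha Hb; apply HtR in Ha, Hb.
  destruct Ha as [_ Ha], Hb as [_ Hb]; split.
  (* [m ∈ n] implies [m ⊆ n], hence [Y \ n ⊆ Y \ m]; the point [m] itself makes the inclusion
     strict. *)
  + intros z; split; [| tauto]; intros Hz; split; auto.
    apply Hb in Hz; apply Ha; split; [tauto |].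
    intros Hzm; apply Hz; eapply omega_elt_trans; eauto.
  + intros ->.
    assert (Hma : m ∈ a) by (apply Ha; split; auto; apply not_mem_self).
    apply Hb in Hma; tauto.
Qed.

(** * The finite-cofinite algebra *)

Context (X F : M) (HX : infinite X) (HF : is_finite_powerset X F).
Context (HXY : subset X Y).

(** Both clauses refer to finite subsets of [X], not of [Y]: with all finite subsets of [Y] allowed,
    the sets [Y \ n] would form a tower. *)
Lemma fincofin_exists : exists S : M, forall A : M,
  A ∈ S <-> A ∈ T /\ (A ∈ F \/ exists B : M, B ∈ F /\ is_diff Y A B).
Proof.
destruct (@separation
  (fun e => e 0 ∈ e 1 \/ exists B : M, B ∈ e 1 /\ is_diff (e 2) (e 0) B)
  (scons F (scons Y (fun _ => Y))) T) as [S HS]; [definable |].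
now exists S.
Qed.

Context (S : M)
  (HS : forall A : M,
     A ∈ S <-> A ∈ T /\ (A ∈ F \/ exists B : M, B ∈ F /\ is_diff Y A B)).

Lemma fin_subset (A B : M) : A ∈ F -> subset B A -> B ∈ F.
Proof.
intros HA HBA; apply HF in HA; destruct HA as [HA Hfin]; apply HF; split.
- intros z Hz; auto.
- eapply finite_subset; eauto.
Qed.

Lemma fin_union (A B C : M) : A ∈ F -> B ∈ F -> is_union A B C -> C ∈ F.
Proof.
intros HA HB HC; apply HF in HA, HB; destruct HA as [HA HA'], HB as [HB HB'].
apply HF; split; [| exact (finite_union HA' HB' HC)].
intros z Hz; apply HC in Hz; destruct Hz; auto.
Qed.

Lemma fin_open (A : M) : A ∈ F -> subset A Y.
Proof. intros HA z Hz; apply HF in HA; apply HXY, HA, Hz. Qed.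

(** Complementation in [Y] exchanges the two clauses that define [S]. *)
Lemma fincofin_diff (A C : M) : A ∈ S -> is_diff Y A C -> C ∈ S.
Proof.
intros HA HC; apply HS in HA; destruct HA as [HAT HA].
assert (HCT : C ∈ T) by (apply HT; intros z Hz; apply HC in Hz; tauto).
apply HS; split; auto; destruct HA as [HA|[B [HB HB']]].
- right; exists A; split; auto; intros z; rewrite (HC z).
  split; [intros Hz; split; [eapply fin_open; eauto | tauto] |].
  intros [Hz H]; apply NNPP; tauto.
- left; replace C with B; auto; apply ext; intros z.
  rewrite (HC z), (HB' z); reflexivity.
Qed.

(** If either set is in [F], so is the smaller intersection; otherwise the two complements are in
    [F], and so is their union. *)
Lemma fincofin_inter (A B C : M) : A ∈ S -> B ∈ S -> is_inter A B C -> C ∈ S.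
Proof.
intros HA HB HC; apply HS in HA, HB.
destruct HA as [HAT HA], HB as [HBT HB].
apply HT in HAT, HBT.
apply HS; split; [apply HT; intros z Hz; apply HC in Hz; apply HAT; tauto |].
destruct HA as [HA|[A' [HA' HA]]].
{ left; apply (fin_subset HA); intros z Hz; apply HC in Hz; tauto. }
destruct HB as [HB|[B' [HB' HB]]].
{ left; apply (fin_subset HB); intros z Hz; apply HC in Hz; tauto. }
right; destruct (union_exists A' B') as [D HD].
exists D; split; [exact (fin_union HA' HB' HD) |].
intros z; rewrite (HD z), (HA z), (HB z), (HC z).
destruct (classic (z ∈ A)); tauto.
Qed.

(** De Morgan reduces this to complements and intersections. *)
Lemma fincofin_union (A B C : M) : A ∈ S -> B ∈ S -> is_union A B C -> C ∈ S.
Proof.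
intros HA HB HC.
destruct (diff_exists Y A) as [A' HA'], (diff_exists Y B) as [B' HB'].
destruct (inter_exists A' B') as [D HD].
assert (HDS : D ∈ S).
{ apply (fincofin_inter (fincofin_diff HA HA') (fincofin_diff HB HB') HD). }
apply (fincofin_diff HDS); intros z.
assert (HAY : z ∈ A -> z ∈ Y).
{ apply HS in HA; destruct HA as [HA _]; apply HT in HA; auto. }
assert (HBY : z ∈ B -> z ∈ Y).
{ apply HS in HB; destruct HB as [HB _]; apply HT in HB; auto. }
rewrite (HC z), (HD z), (HA' z), (HB' z).
destruct (classic (z ∈ A)), (classic (z ∈ B)); tauto.
Qed.

Lemma fin_empty (o : M) : is_empty o -> o ∈ F.
Proof.
intros Ho; apply HF; split; [intros z Hz; destruct (Ho z Hz) |].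
now apply finite_empty.
Qed.

Lemma fincofin_of_fin (A : M) : A ∈ F -> A ∈ S.
Proof. intros HA; apply HS; split; auto; apply HT; now apply fin_open. Qed.

Lemma fincofin_subalgebra : is_subalgebra (RO Y T T) S.
Proof.
assert (HSY : forall A, A ∈ S -> subset A Y).
{ intros A HA; apply HT; apply HS in HA; tauto. }
destruct empty_exists as [o [Ho _]].
split; [intros A HA; apply HS in HA; simpl; tauto |].
repeat split.
- exists o; split; auto; now apply fincofin_of_fin, fin_empty.
- exists Y; split; [reflexivity |].
  apply (@fincofin_diff o); [now apply fincofin_of_fin, fin_empty |].
  intros z; split; [intros Hz; split; auto | tauto].
- intros A B C; apply fincofin_inter.
- intros A B C HA HB HC; apply (fincofin_union HA HB).
  apply discrete_join; auto.
- intros A C HA HC; apply (fincofin_diff HA), discrete_compl; auto.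
Qed.

Lemma fincofin_infinite : infinite S.
Proof.
intros Hfin; apply HX; apply (finite_of_singletons Hfin).
intros x s Hx Hs; apply fincofin_of_fin, HF; split.
- intros z Hz; apply Hs in Hz; destruct Hz; now subst.
- destruct empty_exists as [o [Ho _]].
  apply (finite_adjoin (x := x) (finite_empty Ho)); intros z.
  rewrite (Hs z); split; [tauto | intros [H|H]; [destruct (Ho z H) | auto]].
Qed.

Lemma fincofin_no_tower :
  ~ (exists D : M, subset D F /\ denumerable D) ->
  ~ has_tower (subalgebra (RO Y T T) S).
Proof.
intros HD [t [v [Hv [Ht Hdec]]]]; apply HD; clear HD.
apply omega_unique in Hv; subst v.
cbn in Ht, Hdec; unfold alg_lt in Hdec; cbn in Hdec.
assert (Hsub : forall m n a b : M, m ∈ n -> app t m a -> app t n b ->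
  subset b a /\ b <> a).
{ intros m n a b Hmn Ha Hb.
  destruct (Hdec m n a b) as [Hi Hne]; auto;
    [apply (app_in Ht) in Ha; tauto | apply (app_in Ht) in Hb; tauto |].
  split; auto; intros z Hz; apply Hi in Hz; tauto. }
(* An empty term would have the next term as a proper subset. *)
assert (Hne : forall n a, app t n a -> ~ is_empty a).
{ intros n a Ha He.
  assert (Hn := proj1 (app_in Ht Ha)).
  destruct (adjoin_exists n n) as [s Hs].
  destruct (proj1 (proj2 Ht) s) as [b Hb]; [eapply omega_succ; eauto |].
  destruct (@Hsub n s a b) as [Hba Hne]; auto; [apply Hs; auto |].
  apply Hne, empty_unique; auto; intros z Hz; apply (He z); auto. }
(* [R d n] says that [d] is [d_n]. It runs from sets to numbers because denumerability asks for a
   bijection onto [w]. *)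
pose (R := fun d n : M => exists a : M, app t n a /\
  (a ∈ F /\ d = a \/ ~ a ∈ F /\ is_diff Y a d)).
assert (HRF : forall d n, R d n -> d ∈ F /\ n ∈ w).
{ intros d n [a [Ha Hd]]; apply (app_in Ht) in Ha; destruct Ha as [Hn Ha].
  split; auto; destruct Hd as [[H ->]|[H Hd]]; auto.
  apply HS in Ha; destruct Ha as [_ [Ha|[B [HB HB']]]]; [tauto |].
  replace d with B; auto; apply ext; intros z.
  rewrite (HB' z), (Hd z); reflexivity. }
assert (HR1 : forall d m n, R d m -> R d n -> ~ m ∈ n).
{ intros d m n [a [Ha Hda]] [b [Hb Hdb]] Hmn.
  destruct (@Hsub m n a b) as [Hba Hneq]; auto.
  assert (HbY : subset b Y).
  { apply HT; apply (app_in Ht) in Hb; destruct Hb as [_ Hb].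
    apply HS in Hb; tauto. }
  destruct Hda as [[HaF Hda]|[HaF Hda]], Hdb as [[HbF Hdb]|[HbF Hdb]].
  - congruence.
  (* [b] is a subset of [a ∈ F], hence itself in [F]. *)
  - apply HbF; eapply fin_subset; eauto.
  (* Here [b] is the complement of [a] and also a subset of [a], so it is empty. *)
  - subst d; apply (Hne n b Hb); intros z Hz.
    apply (proj1 (Hda z) Hz); auto.
  (* Equal complements in [Y] force [a = b]. *)
  - apply Hneq, ext; intros z; split; auto; intros Hz; apply NNPP; intros Hzb.
    assert (HaY : z ∈ Y).
    { apply (app_in Ht) in Ha; destruct Ha as [_ Ha]; apply HS in Ha.
      destruct Ha as [Ha _]; apply HT in Ha; auto. }
    assert (Hzd : z ∈ d) by (apply Hdb; auto).
    apply Hda in Hzd; tauto. }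
destruct (@separation (fun e => exists n : M, exists a : M,
  app (e 1) n a /\ (a ∈ e 2 /\ e 0 = a \/ ~ a ∈ e 2 /\ is_diff (e 3) a (e 0)))
  (scons t (scons F (scons Y (fun _ => w)))) F) as [D HD];
  [definable | cbn in HD].
exists D; split; [intros d Hd; apply HD in Hd; tauto |].
exists w; split; auto.
apply (@equipotent_of_relation (fun e => exists a : M, app (e 3) (e 0) a /\
  (a ∈ e 4 /\ e 1 = a \/ ~ a ∈ e 4 /\ is_diff (e 5) a (e 1)))
  (scons t (scons F (scons Y (fun _ => w)))) D w R);
  [definable | reflexivity | ..].
- intros d n Hdn; destruct (HRF _ _ Hdn); split; auto; apply HD; split; auto.
  now exists n.
- intros d Hd; apply HD in Hd; destruct Hd as [_ [n Hn]]; now exists n.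
(* Single-valuedness of [R] is the injectivity of [n ↦ d_n]; comparability of [m] and [n] reduces it
   to [HR1]. *)
- intros d m n Hm Hn; destruct (HRF _ _ Hm), (HRF _ _ Hn).
  destruct (@omega_total m n) as [H'|[H'|H']]; auto.
  + destruct (HR1 d n m); auto.
  + destruct (HR1 d m n); auto.
- intros d d' n [a [Ha Hd]] [a' [Ha' Hd']].
  rewrite <- (proj2 (proj2 Ht) _ _ _ Ha Ha') in Hd'.
  destruct Hd as [[H ->]|[H Hd]], Hd' as [[H' ->]|[H' Hd']]; try tauto.
  apply ext; intros z; rewrite (Hd z), (Hd' z); reflexivity.
- intros n Hn; destruct (proj1 (proj2 Ht) n Hn) as [a Ha].
  destruct (classic (a ∈ F)) as [HaF|HaF].
  + exists a, a; auto.
  + destruct (diff_exists Y a) as [d Hd]; exists d, a; auto.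
Qed.

End Model.

Theorem proposition6p7 (M : structure) (hZF : ZF_model M) (hIQDI : ~ IQDI M) :
  exists X T : M,
    infinite X /\ topology X T /\ hausdorff X T /\
    exists R : M,
      is_RO_set X T R /\
      has_tower (RO X T R) /\
      exists S : M,
        is_subalgebra (RO X T R) S /\
        infinite S /\
        ~ has_tower (subalgebra (RO X T R) S).
Proof.
apply not_all_ex_not in hIQDI; destruct hIQDI as [X HX].
apply not_all_ex_not in HX; destruct HX as [F HX].
apply imply_to_and in HX; destruct HX as [HX HF].
apply imply_to_and in HF; destruct HF as [HF HD].
destruct (omega_exists hZF) as [w Hw].
destruct (union_exists hZF X w) as [Y HY], (ZF_powerset hZF Y) as [T HT].
assert (HXY : subset X Y) by (intros z Hz; apply HY; auto).
assert (HwY : subset w Y) by (intros z Hz; apply HY; auto).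
destruct (fincofin_exists hZF Y T F) as [S HS].
exists Y, T; split; [| split; [| split]].
(* [Y] contains the infinite set [X]. *)
- intros Hfin; apply HX; eapply finite_subset; eauto.
- now apply discrete_topology.
- now apply discrete_hausdorff.
- exists T; split; [| split].
  + now apply discrete_RO_set.
  + now apply (powerset_has_tower hZF Hw HT).
  + exists S; split; [| split].
    * now apply (fincofin_subalgebra hZF Hw HT HF HXY HS).
    * now apply (fincofin_infinite hZF Hw HT HX HF HXY HS).
    * now apply (fincofin_no_tower hZF Hw HT HF HS).
Qed.
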